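(* Let $N\ge1$, $m_c>0$, $0<m\le 1$, $k=Tr^{\alpha}>0$, $\lambda_1,\dots,\lambda_N>0$, $\mathbf{D}=\mathrm{diag}(\lambda_1,\dots,\lambda_N)$, $\mathbf{C}$ an $N\times N$ symmetric positive definite matrix with unit diagonal, and $\hat\lambda_1,\dots,\hat\lambda_N$ the eigenvalues of $\mathbf{D}\mathbf{C}$. Define $$C_p=\frac{\Gamma(Nm_c+m)}{\Gamma(Nm_c+1)\Gamma(m)}\prod_{i=1}^{N}\left(\frac{1}{km\lambda_i+1}\right)^{m_c} F_D^{(N)}\!\left[1-m,m_c,\dots,m_c;Nm_c+1;\tfrac{1}{km\lambda_1+1},\dots,\tfrac{1}{km\lambda_N+1}\right]$$ and $\hat C_p$ by the same formula with every $\lambda_i$ replaced by $\hat\lambda_i$. Then $\hat C_p\ge C_p$; that is, when the user's Nakagami shape parameter satisfies $m\le1$, the coverage probability with correlated interferers is at least that with independent interferers.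
   Context: $F_D^{(N)}$ is Lauricella's fourth hypergeometric function: $F_D^{(N)}[a,b_1,\dots,b_N;c;x_1,\dots,x_N]=\sum_{i_1,\dots,i_N\ge0}\frac{(a)_{i_1+\dots+i_N}(b_1)_{i_1}\cdots(b_N)_{i_N}}{(c)_{i_1+\dots+i_N}}\frac{x_1^{i_1}}{i_1!}\cdots\frac{x_N^{i_N}}{i_N!}$ for $\max|x_j|<1$, with $(a)_n=\Gamma(a+n)/\Gamma(a)$. Interpretation: $C_p=P(g\ge k I)$ where $g\sim$ Gamma with shape $m$ and scale $1/m$ (user's Nakagami-$m$ channel power), $I=\sum_i\lambda_iG_i$ with $G_i$ i.i.d. Gamma$(m_c,1)$ independent of $g$, and $\hat C_p$ is the same with $\hat\lambda_i$ (correlated interferers); $\lambda_i=d_i^{-\alpha}/m_c$ and $\mathbf{C}$ has off-diagonal entries $\sqrt{\rho_{ij}}$, $\rho_{ij}\in[0,1]$. *)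

(* Defs.v *)
From Stdlib Require Import Reals Lra Lia Arith Factorial ClassicalEpsilon.
Open Scope R_scope.

Fixpoint sumR (n : nat) (f : nat -> R) : R :=
  match n with O => 0 | S n' => sumR n' f + f n' end.
Fixpoint prodR (n : nat) (f : nat -> R) : R :=
  match n with O => 1 | S n' => prodR n' f * f n' end.

Fixpoint poch (a : R) (n : nat) : R :=
  match n with O => 1 | S n' => poch a n' * (a + INR n') end.

(* Euler Gamma function, via Gauss' limit formula
   Gamma x = lim_n n! n^x / (x (x+1) ... (x+n))   (x > 0) *)
Definition gauss_seq (x : R) (n : nat) : R :=
  INR (fact n) * Rpower (INR n) x / poch x (S n).
Definition Gamma (x : R) : R :=
  epsilon (inhabits 0) (fun g => Un_cv (gauss_seq x) g).

(* Partial sums of Lauricella's F_D^{(n)} over the cube of multi-indices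
   {0..K}^n.  s = i_1+...+i_n accumulated so far, w = product of the
   single-variable factors accumulated so far. *)
Fixpoint fd_partial (a c : R) (b x : nat -> R) (n K : nat) (s : nat) (w : R)
  : R :=
  match n with
  | O => poch a s / poch c s * w
  | S n' => sum_f_R0 (fun i => fd_partial a c b x n' K (s + i)
              (w * poch (b n') i * x n' ^ i / INR (fact i))) K
  end.

Definition LauricellaFD (n : nat) (a : R) (b : nat -> R) (c : R)
  (x : nat -> R) : R :=
  epsilon (inhabits 0)
    (fun L => Un_cv (fun K => fd_partial a c b x n K 0 1) L).

Definition Cp (N : nat) (mc m k : R) (lam : nat -> R) : R :=
  Gamma (INR N * mc + m) / (Gamma (INR N * mc + 1) * Gamma m)
  * prodR N (fun i => Rpower (1 / (k * m * lam i + 1)) mc)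
  * LauricellaFD N (1 - m) (fun _ => mc) (INR N * mc + 1)
      (fun i => 1 / (k * m * lam i + 1)).

Definition minor (A : nat -> nat -> R) (j : nat) : nat -> nat -> R :=
  fun r c => A (S r) (if Nat.ltb c j then c else S c).
Fixpoint det (n : nat) (A : nat -> nat -> R) : R :=
  match n with
  | O => 1
  | S n' => sumR n (fun j => (-1) ^ j * A O j * det n' (minor A j))
  end.

(* mu_0..mu_{n-1} are the eigenvalues (with algebraic multiplicity) of A:
   det(t I - A) = prod_i (t - mu_i) for all t. *)
Definition is_eigenvalues (n : nat) (A : nat -> nat -> R) (mu : nat -> R)
  : Prop :=
  forall t : R,
    det n (fun i j => (if Nat.eqb i j then t else 0) - A i j)
    = prodR n (fun i => t - mu i).

Definition symmetric (n : nat) (C : nat -> nat -> R) : Prop :=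
  forall i j, (i < n)%nat -> (j < n)%nat -> C i j = C j i.

Definition pos_def (n : nat) (C : nat -> nat -> R) : Prop :=
  forall x : nat -> R, (exists i, (i < n)%nat /\ x i <> 0) ->
    0 < sumR n (fun i => sumR n (fun j => x i * C i j * x j)).

(* Main.v *)
(** If [u] is Beta(1 - m, N mc + m) distributed, its moments are
    [(1-m)_s / (N mc + 1)_s], so that [F_D] is the expectation of
    [prod_i (1 - u x_i)^-mc].  With [x_i = 1 / (y_i + 1)], [y_i = k m lam_i],
    the coverage probability is then a nonnegative constant times the expectation of
    [(prod_i (1 - u + y_i))^-mc].  For [tau = (1 - u) / (k m)] this product is, up to
    [(k m)^N], the product of [tau + lam_i], respectively
    [prod_i (tau + lamh_i) = det (tau I + D C) = det D * det (tau D^-1 + C)], and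
    Hadamard's inequality for the positive definite matrix [tau D^-1 + C] makes the
    latter the smaller one; the comparison holds already pointwise in [u].

    The Beta law, degenerate for [m = 1], is replaced by the proportion of draws in a
    Polya urn, whose factorial moments are explicit and which converges to it. *)

Require Import Defs.
From Stdlib Require Import Reals Lra Lia Arith ClassicalEpsilon.
From Coquelicot Require Import Coquelicot.
From mathcomp Require all_boot all_order all_algebra Rstruct.
Open Scope R_scope.

(** * Convergence of Gauss' product *)

Lemma poch_pos (a : R) (n : nat) : 0 < a -> 0 < poch a n.
Proof.
  intros Ha; induction n as [|n IH]; simpl; [lra|].
  apply Rmult_lt_0_compat; [exact IH|]. pose proof (pos_INR n); lra.
Qed.

Lemma poch_nonneg (a : R) (n : nat) : 0 <= a -> 0 <= poch a n.
Proof.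
  intros Ha; induction n as [|n IH]; simpl; [lra|].
  apply Rmult_le_pos; [exact IH|]. pose proof (pos_INR n); lra.
Qed.

Lemma poch_shift (a : R) (n : nat) : poch a (S n) = a * poch (a + 1) n.
Proof.
  induction n as [|n IH]; [simpl; lra|].
  change (poch a (S (S n))) with (poch a (S n) * (a + INR (S n))).
  rewrite IH, S_INR; simpl poch; lra.
Qed.

Lemma ln_le_sub1 (y : R) : 0 < y -> ln y <= y - 1.
Proof.
  intros Hy. pose proof (exp_ineq1_le (ln y)) as H.
  rewrite exp_ln in H by exact Hy; lra.
Qed.

Lemma ln_ge_sub_inv (y : R) : 0 < y -> 1 - / y <= ln y.
Proof.
  intros Hy. assert (H : 0 < / y) by (apply Rinv_0_lt_compat; exact Hy).
  pose proof (ln_le_sub1 _ H). rewrite ln_Rinv in H0 by exact Hy. lra.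
Qed.

Lemma gauss_seq_pos (x : R) (n : nat) : 0 < x -> 0 < gauss_seq x n.
Proof.
  intros Hx; unfold gauss_seq, Rdiv.
  apply Rmult_lt_0_compat; [apply Rmult_lt_0_compat|].
  - apply INR_fact_lt_0.
  - apply exp_pos.
  - apply Rinv_0_lt_compat, poch_pos, Hx.
Qed.

Lemma ln_gauss_seq (x : R) (n : nat) : 0 < x ->
  ln (gauss_seq x n) = ln (INR (fact n)) + x * ln (INR n) - ln (poch x (S n)).
Proof.
  intros Hx; unfold gauss_seq, Rdiv.
  pose proof (INR_fact_lt_0 n). pose proof (poch_pos x (S n) Hx).
  assert (0 < Rpower (INR n) x) by apply exp_pos.
  rewrite ln_mult, ln_mult, ln_Rinv; auto.
  - unfold Rpower; rewrite ln_exp; lra.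
  - apply Rmult_lt_0_compat; auto.
  - apply Rinv_0_lt_compat; auto.
Qed.

Lemma ln_gauss_seq_step (x : R) (n : nat) : 0 < x ->
  ln (gauss_seq x (S (S n))) - ln (gauss_seq x (S n))
  = x * ln (INR (S (S n)) / INR (S n)) - ln ((x + INR (S (S n))) / INR (S (S n))).
Proof.
  intros Hx. rewrite !ln_gauss_seq by exact Hx.
  set (p := S n).
  assert (Hp : 0 < INR p) by (apply lt_0_INR; unfold p; lia).
  assert (Hq : 0 < INR (S p)) by (apply lt_0_INR; lia).
  change (poch x (S (S p))) with (poch x (S p) * (x + INR (S p))).
  change (fact (S p)) with ((S p) * fact p)%nat.
  pose proof (INR_fact_lt_0 p). pose proof (poch_pos x (S p) Hx).
  rewrite mult_INR.
  rewrite !ln_mult, !ln_div; auto; lra.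
Qed.

(** [Gamma] is an [epsilon] choice, so nothing is known of it before a limit exists. The logarithmic
    increments are squeezed by [1 - / y <= ln y <= y - 1]: they are nonnegative and dominated by a
    telescoping sum. *)
Lemma gauss_seq_cv (x : R) : 0 < x -> exists l, Un_cv (gauss_seq x) l.
Proof.
  intros Hx.
  assert (Hgrow : Un_growing (fun n => gauss_seq x (S n))).
  { intro n. cut (ln (gauss_seq x (S n)) <= ln (gauss_seq x (S (S n)))).
    { intro H. rewrite <- (exp_ln (gauss_seq x (S n))), <- (exp_ln (gauss_seq x (S (S n))))
        by (apply gauss_seq_pos; exact Hx).
      destruct H as [H|H]; [left; apply exp_increasing, H | rewrite H; lra]. }
    cut (0 <= ln (gauss_seq x (S (S n))) - ln (gauss_seq x (S n))); [lra|].
    rewrite ln_gauss_seq_step by exact Hx.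
    assert (Hp : 0 < INR (S n)) by (apply lt_0_INR; lia).
    assert (Hq : 0 < INR (S (S n))) by (apply lt_0_INR; lia).
    (* Both logarithms of the increment are compared with the same number [x / INR (S (S n))], the
       first from below and the second from above. *)
    pose proof (ln_ge_sub_inv (INR (S (S n)) / INR (S n))
                  ltac:(apply Rdiv_lt_0_compat; auto)) as H1.
    pose proof (ln_le_sub1 ((x + INR (S (S n))) / INR (S (S n)))
                  ltac:(apply Rdiv_lt_0_compat; lra)) as H2.
    apply (Rmult_le_compat_l x) in H1; [|lra].
    cut (x * (1 - / (INR (S (S n)) / INR (S n))) = (x + INR (S (S n))) / INR (S (S n)) - 1); [lra|].
    rewrite !S_INR in *. field; lra. }
  (* The correction makes the left side nonincreasing: with [p = n + 1] the increment is at most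
     [x (1 + x) / (p (p + 1 + x))], hence at most [x (1 + x) (1/p - 1/(p+1))]. *)
  assert (Hbd : forall n, ln (gauss_seq x (S n)) + x * (1 + x) / INR (S n)
                          <= ln (gauss_seq x 1) + x * (1 + x)).
  { induction n as [|n IH]; [simpl; lra|].
    eapply Rle_trans; [|exact IH].
    cut (ln (gauss_seq x (S (S n))) - ln (gauss_seq x (S n))
         <= x * (1 + x) / INR (S n) - x * (1 + x) / INR (S (S n))); [lra|].
    rewrite ln_gauss_seq_step by exact Hx.
    assert (Hp : 0 < INR (S n)) by (apply lt_0_INR; lia).
    assert (Hq : 0 < INR (S (S n))) by (apply lt_0_INR; lia).
    pose proof (ln_le_sub1 (INR (S (S n)) / INR (S n))
                  ltac:(apply Rdiv_lt_0_compat; auto)) as H1.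
    pose proof (ln_ge_sub_inv ((x + INR (S (S n))) / INR (S (S n)))
                  ltac:(apply Rdiv_lt_0_compat; lra)) as H2.
    apply (Rmult_le_compat_l x) in H1; [|lra].
    rewrite (S_INR (S n)) in *. set (p := INR (S n)) in *.
    assert (H3 : x * ((p + 1) / p - 1) - (1 - / ((x + (p + 1)) / (p + 1)))
            = x * (1 + x) / (p * (x + (p + 1)))) by (field; lra).
    assert (H4 : x * (1 + x) / p - x * (1 + x) / (p + 1) = x * (1 + x) / (p * (p + 1)))
      by (field; lra).
    rewrite H4. eapply Rle_trans with (x * (1 + x) / (p * (x + (p + 1)))); [lra|].
    apply Rmult_le_compat_l; [nra|]. apply Rinv_le_contravar; nra. }
  destruct (growing_cv (fun n => gauss_seq x (S n)) Hgrow) as [l Hl].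
  { exists (exp (ln (gauss_seq x 1) + x * (1 + x))). intros y [n ->].
    rewrite <- (exp_ln (gauss_seq x (S n))) by (apply gauss_seq_pos; exact Hx).
    apply Rle_trans with (exp (ln (gauss_seq x (S n)) + x * (1 + x) / INR (S n))).
    - assert (0 <= x * (1 + x) / INR (S n)).
      { apply Rdiv_le_0_compat; [nra | apply lt_0_INR; lia]. }
      destruct (Req_dec (x * (1 + x) / INR (S n)) 0) as [->|Hne].
      + rewrite Rplus_0_r; lra.
      + left; apply exp_increasing; lra.
    - destruct (Hbd n) as [H|H]; [left; apply exp_increasing, H | rewrite H; lra]. }
  exists l. intros e He. destruct (Hl e He) as [M HM]. exists (S M).
  intros [|n] Hn; [lia|]. apply HM; lia.
Qed.

Lemma Un_cv_le (u v : nat -> R) (lu lv : R) :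
  (forall n, u n <= v n) -> Un_cv u lu -> Un_cv v lv -> lu <= lv.
Proof.
  intros H Hu Hv. apply is_lim_seq_Reals in Hu, Hv.
  exact (is_lim_seq_le u v lu lv H Hu Hv).
Qed.

Lemma Un_cv_const (c : R) : Un_cv (fun _ => c) c.
Proof. apply is_lim_seq_Reals, is_lim_seq_const. Qed.

(** The Gamma quotient is a common factor of both coverage probabilities, so only its sign
    matters. *)
Lemma Gamma_nonneg (x : R) : 0 < x -> 0 <= Gamma x.
Proof.
  intros Hx. apply Un_cv_le with (fun _ => 0) (gauss_seq x).
  - intro n; left; apply gauss_seq_pos, Hx.
  - apply Un_cv_const.
  - unfold Gamma; apply epsilon_spec, gauss_seq_cv, Hx.
Qed.

(** * Beta moments through the Polya urn *)

(* Expectation of [f] at the number of [a]-draws among the first [n] draws of a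
   Polya urn with initial weights [a] and [b]. *)
Fixpoint polya (a b : R) (n : nat) (f : nat -> R) : R :=
  match n with
  | O => f O
  | S n' => a / (a + b) * polya (a + 1) b n' (fun j => f (S j))
            + b / (a + b) * polya a (b + 1) n' f
  end.

(** The weight [a] may vanish; this covers [m = 1], where [a = 1 - m = 0]. *)
Lemma polya_le (a b : R) (n : nat) (f g : nat -> R) :
  0 <= a -> 0 < b -> (forall j, (j <= n)%nat -> f j <= g j) ->
  polya a b n f <= polya a b n g.
Proof.
  revert a b f g; induction n as [|n IH]; intros a b f g Ha Hb H; simpl.
  - apply H; lia.
  - apply Rplus_le_compat; apply Rmult_le_compat_l.
    + apply Rdiv_le_0_compat; lra.
    + apply IH; try lra. intros j Hj; apply H; lia.
    + apply Rdiv_le_0_compat; lra.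
    + apply IH; try lra. intros j Hj; apply H; lia.
Qed.

Lemma polya_ext (a b : R) (n : nat) (f g : nat -> R) :
  (forall j, f j = g j) -> polya a b n f = polya a b n g.
Proof.
  revert a b f g; induction n as [|n IH]; intros a b f g H; simpl; [apply H|].
  rewrite (IH (a + 1) b (fun j => f (S j)) (fun j => g (S j))) by (intro; apply H).
  rewrite (IH a (b + 1) f g H); reflexivity.
Qed.

Lemma polya_plus (a b : R) (n : nat) (f g : nat -> R) :
  polya a b n (fun j => f j + g j) = polya a b n f + polya a b n g.
Proof.
  revert a b f g; induction n as [|n IH]; intros a b f g; simpl; [reflexivity|].
  rewrite (IH (a + 1) b (fun j => f (S j)) (fun j => g (S j))), (IH a (b + 1) f g); ring.
Qed.

Lemma polya_scal (a b c : R) (n : nat) (f : nat -> R) :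
  polya a b n (fun j => c * f j) = c * polya a b n f.
Proof.
  revert a b f; induction n as [|n IH]; intros a b f; simpl; [reflexivity|].
  rewrite (IH (a + 1) b (fun j => f (S j))), (IH a (b + 1) f); ring.
Qed.

Lemma polya_const (a b c : R) (n : nat) :
  0 <= a -> 0 < b -> polya a b n (fun _ => c) = c.
Proof.
  revert a b; induction n as [|n IH]; intros a b Ha Hb; simpl; [reflexivity|].
  rewrite !IH by lra. field; lra.
Qed.

Lemma polya_sum (a b : R) (n K : nat) (f : nat -> nat -> R) :
  polya a b n (fun j => sum_f_R0 (fun i => f i j) K)
  = sum_f_R0 (fun i => polya a b n (f i)) K.
Proof.
  induction K as [|K IH]; simpl.
  - apply polya_ext; reflexivity.
  - rewrite <- IH, <- polya_plus; reflexivity.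
Qed.

Fixpoint falling (x : R) (s : nat) : R :=
  match s with O => 1 | S s' => falling x s' * (x - INR s') end.

Lemma falling_shift (x : R) (s : nat) :
  falling (x + 1) (S s) = (x + 1) * falling x s.
Proof.
  induction s as [|s IH]; [simpl; lra|].
  change (falling (x + 1) (S (S s))) with (falling (x + 1) (S s) * (x + 1 - INR (S s))).
  rewrite IH, S_INR; simpl; ring.
Qed.

Lemma falling_0 (s : nat) : falling 0 (S s) = 0.
Proof. induction s as [|s IH]; [simpl; lra|]. cbn [falling] in *. rewrite IH; ring. Qed.

Lemma falling_nonneg (j s : nat) : 0 <= falling (INR j) s.
Proof.
  revert s; induction j as [|j IH]; intros [|s]; try (simpl; lra).
  - change (INR 0) with 0. rewrite falling_0; lra.
  - rewrite S_INR, falling_shift. apply Rmult_le_pos; [|apply IH].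
    pose proof (pos_INR j); lra.
Qed.

(* The factorial moments of the urn are those of its Beta(a,b) limit, up to
   the factor [falling n s]. *)
Lemma polya_falling (a b : R) (n s : nat) : 0 <= a -> 0 < b ->
  polya a b n (fun j => falling (INR j) s)
  = falling (INR n) s * (poch a s / poch (a + b) s).
Proof.
  revert a b s; induction n as [|n IH]; intros a b s Ha Hb.
  - destruct s as [|s]; [simpl; field|].
    cbn [polya]. change (INR 0) with 0. rewrite falling_0; ring.
  - destruct s as [|s].
    { simpl falling. rewrite polya_const by lra. simpl; field. }
    cbn [polya].
    (* Pascal's rule for falling factorials turns the shift caused by a first [a]-draw into
       unshifted moments of orders [s + 1] and [s]. *)
    rewrite (polya_ext _ _ _ (fun j => falling (INR (S j)) (S s))
      (fun j => falling (INR j) (S s) + (INR s + 1) * falling (INR j) s)).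
    2:{ intro j. rewrite S_INR, falling_shift. simpl; ring. }
    rewrite polya_plus, polya_scal, !IH by lra.
    rewrite (S_INR n), falling_shift.
    replace (a + 1 + b) with (a + b + 1) by ring.
    replace (a + (b + 1)) with (a + b + 1) by ring.
    rewrite !(poch_shift a), !(poch_shift (a + b)). simpl falling; simpl poch.
    pose proof (pos_INR s).
    assert (0 < poch (a + b + 1) s) by (apply poch_pos; lra).
    field. repeat split; lra.
Qed.

(** With [u = j / n] and [q = falling j s / n^s], the error [e_s] satisfies
    [e_(s+1) = u e_s + (s / n) q]. Since [u] and [q] lie in [0, 1], it grows by at most [s / n] per
    step, uniformly in [j]. *)
Lemma falling_pow_bound (n j s : nat) : (0 < n)%nat -> (j <= n)%nat ->
  0 <= (INR j / INR n) ^ s - falling (INR j) s / INR n ^ s <= INR s * INR s / INR n.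
Proof.
  intros Hn Hj.
  assert (Hn' : 0 < INR n) by (apply lt_0_INR; lia).
  assert (Hu : 0 <= INR j / INR n <= 1).
  { split; [apply Rdiv_le_0_compat; [apply pos_INR | exact Hn']|].
    apply Rle_div_l; [exact Hn'|]. rewrite Rmult_1_l. apply le_INR, Hj. }
  induction s as [|s IH].
  { simpl. lra. }
  assert (Hq : 0 <= falling (INR j) s / INR n ^ s).
  { apply Rdiv_le_0_compat; [apply falling_nonneg | apply pow_lt, Hn']. }
  assert (Hq1 : falling (INR j) s / INR n ^ s <= 1).
  { apply Rle_trans with ((INR j / INR n) ^ s); [lra|].
    rewrite <- (pow1 s). apply pow_incr; lra. }
  set (u := INR j / INR n) in *. set (q := falling (INR j) s / INR n ^ s) in *.
  assert (E : u ^ (S s) - falling (INR j) (S s) / INR n ^ (S s)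
              = u * (u ^ s - q) + INR s / INR n * q).
  { unfold u, q. simpl. field. split; [apply pow_nonzero|]; lra. }
  rewrite E, S_INR.
  assert (Hs : 0 <= INR s / INR n) by (apply Rdiv_le_0_compat; [apply pos_INR | exact Hn']).
  assert (Hi : 0 < / INR n) by (apply Rinv_0_lt_compat, Hn').
  pose proof (pos_INR s).
  split; [apply Rplus_le_le_0_compat; apply Rmult_le_pos; lra|].
  assert (u * (u ^ s - q) <= INR s * INR s / INR n) by nra.
  assert (INR s / INR n * q <= INR s / INR n) by nra.
  replace ((INR s + 1) * (INR s + 1) / INR n)
    with (INR s * INR s / INR n + INR s / INR n + (INR s + 1) * / INR n) by (field; lra).
  nra.
Qed.

(** Powers differ from normalized falling factorials by O(1/n) uniformly in [j], and the moments of
    the latter are exact. The index [S n] avoids division by zero. *)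
Lemma polya_pow_cv (a b : R) (s : nat) : 0 <= a -> 0 < b ->
  Un_cv (fun n => polya a b (S n) (fun j => (INR j / INR (S n)) ^ s))
        (poch a s / poch (a + b) s).
Proof.
  intros Ha Hb. set (mu := poch a s / poch (a + b) s).
  assert (Hmu : 0 <= mu).
  { apply Rdiv_le_0_compat; [apply poch_nonneg | apply poch_pos]; lra. }
  apply is_lim_seq_Reals.
  assert (Hinv : forall c, is_lim_seq (fun n => c * / INR (S n)) 0).
  { intro c. replace (Finite 0) with (Rbar_mult c 0) by (simpl; f_equal; ring).
    apply is_lim_seq_scal_l.
    apply (is_lim_seq_incr_1 (fun n => / INR n)).
    apply (is_lim_seq_inv INR p_infty); [apply is_lim_seq_INR | easy]. }
  apply (is_lim_seq_le_le (fun n => mu - INR s * INR s * mu * / INR (S n)) _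
           (fun n => mu + INR s * INR s * / INR (S n))).
  - intro n.
    assert (Hn : 0 < INR (S n)) by (apply lt_0_INR; lia).
    assert (Hp : INR (S n) ^ s <> 0) by (apply pow_nonzero; lra).
    assert (E : polya a b (S n) (fun j => / INR (S n) ^ s * falling (INR j) s)
                = falling (INR (S n)) s / INR (S n) ^ s * mu).
    { rewrite polya_scal, polya_falling by assumption. unfold mu; unfold Rdiv; ring. }
    (* The same bound at [j = n] controls the normalizing ratio [r]: it lies within O(1/n) below
       1. *)
    pose proof (falling_pow_bound (S n) (S n) s ltac:(lia) ltac:(lia)) as Hb1.
    rewrite (Rdiv_diag (INR (S n))), pow1 in Hb1 by lra.
    set (r := falling (INR (S n)) s / INR (S n) ^ s) in *.
    split.
    + apply Rle_trans with (r * mu).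
      * unfold Rdiv in Hb1. nra.
      * rewrite <- E. apply polya_le; try assumption. intros j Hj.
        pose proof (falling_pow_bound (S n) j s ltac:(lia) Hj). unfold Rdiv in *; lra.
    + apply Rle_trans with (r * mu + INR s * INR s * / INR (S n)); [|nra].
      rewrite <- E. rewrite <- (polya_const a b (INR s * INR s * / INR (S n)) (S n)) by assumption.
      rewrite <- polya_plus. apply polya_le; try assumption. intros j Hj.
      pose proof (falling_pow_bound (S n) j s ltac:(lia) Hj). unfold Rdiv in *; lra.
  - replace (Finite mu) with (Finite (mu - 0)) by (f_equal; ring).
    apply is_lim_seq_minus'; [apply is_lim_seq_const | apply Hinv].
  - replace (Finite mu) with (Finite (mu + 0)) by (f_equal; ring).
    apply is_lim_seq_plus'; [apply is_lim_seq_const | apply Hinv].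
Qed.

(** * The binomial series *)

(** The Taylor coefficients of [(1 - z)^-b] at 0. *)
Definition binom_coef (b : R) (i : nat) : R := poch b i / INR (fact i).

Definition binom_sum (b : R) (K : nat) (z : R) : R :=
  sum_f_R0 (fun i => binom_coef b i * z ^ i) K.

Lemma binom_coef_pos (b : R) (i : nat) : 0 < b -> 0 < binom_coef b i.
Proof. intro Hb. apply Rdiv_lt_0_compat; [apply poch_pos, Hb | apply INR_fact_lt_0]. Qed.

Lemma binom_coef_S (b : R) (i : nat) :
  INR (S i) * binom_coef b (S i) = (b + INR i) * binom_coef b i.
Proof.
  unfold binom_coef. simpl poch. change (fact (S i)) with ((S i) * fact i)%nat.
  rewrite mult_INR. pose proof (INR_fact_lt_0 i).
  assert (0 < INR (S i)) by (apply lt_0_INR; lia). field; lra.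
Qed.

(** Ratio test: consecutive coefficients have quotient [(b + n) / (n + 1) = 1 + (b - 1) / (n +
    1)]. *)
Lemma binom_CV_radius (b : R) : 0 < b -> CV_radius (binom_coef b) = 1.
Proof.
  intro Hb.
  replace (Finite 1) with (Finite (/ 1)) by (f_equal; field).
  apply CV_radius_finite_DAlembert; [|lra|].
  { intro n; pose proof (binom_coef_pos b n Hb); lra. }
  apply is_lim_seq_ext with (fun n => 1 + (b - 1) * / INR (S n)).
  { intro n. pose proof (binom_coef_pos b n Hb). pose proof (binom_coef_pos b (S n) Hb).
    rewrite Rabs_pos_eq by (left; apply Rdiv_lt_0_compat; assumption).
    assert (Hn : 0 < INR (S n)) by (apply lt_0_INR; lia).
    replace (binom_coef b (S n)) with ((b + INR n) * binom_coef b n / INR (S n)).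
    - rewrite S_INR in *. field; lra.
    - rewrite <- binom_coef_S. field; lra. }
  replace (Finite 1) with (Finite (1 + (b - 1) * 0)) by (f_equal; ring).
  apply is_lim_seq_plus'; [apply is_lim_seq_const|].
  apply is_lim_seq_mult'; [apply is_lim_seq_const|].
  apply (is_lim_seq_incr_1 (fun n => / INR n)).
  apply (is_lim_seq_inv INR p_infty); [apply is_lim_seq_INR | easy].
Qed.

(* The series [f] satisfies [(1 - z) f' = b f], so [f z * (1 - z)^b] is constant. *)
Lemma binom_PSeries (b z : R) : 0 < b -> 0 <= z < 1 ->
  PSeries (binom_coef b) z = Rpower (1 - z) (- b).
Proof.
  intros Hb Hz.
  assert (Hcv : forall t, 0 <= t < 1 -> Rbar_lt (Rabs t) (CV_radius (binom_coef b))).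
  { intros t Ht. rewrite binom_CV_radius by exact Hb. simpl.
    rewrite Rabs_pos_eq; lra. }
  assert (Hode : forall t, 0 <= t < 1 ->
     PSeries (PS_derive (binom_coef b)) t * (1 - t) = b * PSeries (binom_coef b) t).
  { intros t Ht.
    assert (Ha : ex_pseries (binom_coef b) t) by (apply CV_radius_inside, Hcv, Ht).
    assert (Hd : ex_pseries (PS_derive (binom_coef b)) t).
    { apply CV_radius_inside. rewrite CV_radius_derive. apply Hcv, Ht. }
    (* Written as [f' = t f' + b f], the equation is coefficientwise the recursion
       [binom_coef_S]. *)
    cut (PSeries (PS_derive (binom_coef b)) t
         = t * PSeries (PS_derive (binom_coef b)) t + b * PSeries (binom_coef b) t); [lra|].
    rewrite <- PSeries_incr_1, <- PSeries_scal, <- PSeries_plus.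
    - apply PSeries_ext. intro n. unfold PS_plus, PS_scal, PS_incr_1, PS_derive.
      rewrite binom_coef_S. destruct n as [|n].
      + change ((b + 0) * binom_coef b 0 = 0 + b * binom_coef b 0). ring.
      + change ((b + INR (S n)) * binom_coef b (S n)
                = INR (S n) * binom_coef b (S n) + b * binom_coef b (S n)). ring.
    - apply ex_pseries_incr_1, Hd.
    - apply ex_pseries_scal; [apply Rmult_comm | exact Ha]. }
  set (h := fun t => PSeries (binom_coef b) t * Rpower (1 - t) b).
  assert (Hh : forall t, 0 <= t < 1 -> is_derive h t 0).
  { intros t Ht. unfold h.
    pose proof (is_derive_PSeries (binom_coef b) t (Hcv t Ht)) as H1.
    assert (H2 : is_derive (fun t => Rpower (1 - t) b) t
                  (- b * / (1 - t) * Rpower (1 - t) b)).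
    { unfold Rpower. auto_derive; [lra|]. change (1 + - t) with (1 - t). field; lra. }
    pose proof (is_derive_mult _ _ t _ _ H1 H2 Rmult_comm) as H3.
    evar_last; [exact H3|].
    unfold plus, mult; simpl.
    replace (PSeries (binom_coef b) t)
      with (PSeries (PS_derive (binom_coef b)) t * (1 - t) / b)
      by (rewrite Hode by exact Ht; field; lra).
    field; lra. }
  assert (Hconst : h z = h 0).
  { destruct (Req_dec z 0) as [->|Hne]; [reflexivity|].
    destruct (MVT_gen h 0 z (fun _ => 0)) as [c [_ Hc]].
    - intros t Ht. rewrite Rmin_left, Rmax_right in Ht by lra. apply Hh; lra.
    - intros t Ht. rewrite Rmin_left, Rmax_right in Ht by lra.
      apply continuity_pt_filterlim, (ex_derive_continuous h).
      exists 0; apply Hh; lra.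
    - lra. }
  unfold h in Hconst. rewrite PSeries_0, Rminus_0_r in Hconst.
  unfold Rpower at 2 in Hconst. rewrite ln_1, Rmult_0_r, exp_0 in Hconst.
  unfold binom_coef at 2 in Hconst. simpl in Hconst.
  rewrite Rpower_Ropp.
  apply Rmult_eq_reg_r with (Rpower (1 - z) b); [|unfold Rpower; apply Rgt_not_eq, exp_pos].
  rewrite Hconst, Rinv_l; [field|unfold Rpower; apply Rgt_not_eq, exp_pos].
Qed.

Lemma binom_sum_cv (b z : R) : 0 < b -> 0 <= z < 1 ->
  Un_cv (fun K => binom_sum b K z) (Rpower (1 - z) (- b)).
Proof.
  intros Hb Hz. rewrite <- binom_PSeries by assumption.
  apply is_lim_seq_Reals.
  assert (Ha : ex_pseries (binom_coef b) z).
  { apply CV_radius_inside. rewrite binom_CV_radius by exact Hb. simpl.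
    rewrite Rabs_pos_eq; lra. }
  apply PSeries_correct in Ha. apply is_pseries_R in Ha.
  eapply is_lim_seq_ext; [|exact Ha]. intro n; apply sum_n_Reals.
Qed.

Lemma binom_sum_shift_cv (b z : R) (K : nat) : 0 < b -> 0 <= z < 1 ->
  Un_cv (fun p => binom_sum b (K + p) z) (Rpower (1 - z) (- b)).
Proof.
  intros Hb Hz. apply is_lim_seq_Reals.
  apply is_lim_seq_ext with (fun p => binom_sum b (p + K) z).
  { intro p; rewrite Nat.add_comm; reflexivity. }
  apply (is_lim_seq_incr_n (fun p => binom_sum b p z)), is_lim_seq_Reals.
  apply binom_sum_cv; assumption.
Qed.

Lemma binom_sum_S (b z : R) (K : nat) :
  binom_sum b (S K) z = binom_sum b K z + binom_coef b (S K) * z ^ S K.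
Proof. reflexivity. Qed.

Lemma binom_sum_ge1 (b z : R) (K : nat) : 0 < b -> 0 <= z -> 1 <= binom_sum b K z.
Proof.
  intros Hb Hz. induction K as [|K IH].
  - unfold binom_sum, binom_coef; simpl; lra.
  - rewrite binom_sum_S.
    assert (0 <= binom_coef b (S K) * z ^ S K).
    { apply Rmult_le_pos; [left; apply binom_coef_pos, Hb | apply pow_le, Hz]. }
    lra.
Qed.

(** Every term is nonnegative and nondecreasing in [z]. Taking [x = z] gives monotonicity in the
    order of truncation, and [K = 0] gives monotonicity in [z]. *)
Lemma binom_sum_tail_incr (b z x : R) (K p : nat) : 0 < b -> 0 <= z <= x ->
  0 <= binom_sum b (K + p) z - binom_sum b K z
    <= binom_sum b (K + p) x - binom_sum b K x.
Proof.
  intros Hb Hz. induction p as [|p IH].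
  - rewrite Nat.add_0_r; lra.
  - rewrite Nat.add_succ_r, !binom_sum_S.
    pose proof (binom_coef_pos b (S (K + p)) Hb).
    pose proof (pow_le z (S (K + p)) ltac:(lra)).
    pose proof (pow_incr z x (S (K + p)) Hz). nra.
Qed.

Lemma binom_sum_le (b z : R) (K : nat) : 0 < b -> 0 <= z < 1 ->
  binom_sum b K z <= Rpower (1 - z) (- b).
Proof.
  intros Hb Hz. apply Un_cv_le with (fun _ => binom_sum b K z) (fun p => binom_sum b (K + p) z).
  - intro p. pose proof (binom_sum_tail_incr b z z K p Hb ltac:(lra)); lra.
  - apply Un_cv_const.
  - apply binom_sum_shift_cv; assumption.
Qed.

(** A factor, not an additive error: it pulls out of the product over the variables and, being
    independent of [u], out of the urn expectation. *)
Definition binom_excess (b x : R) (K : nat) : R :=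
  1 + (Rpower (1 - x) (- b) - binom_sum b K x).

(* The relative truncation error is uniform on [0, x]: the tail increases with [z]
   and the partial sums are at least 1. *)
Lemma binom_le_excess (b z x : R) (K : nat) : 0 < b -> 0 <= z <= x -> x < 1 ->
  Rpower (1 - z) (- b) <= binom_excess b x K * binom_sum b K z.
Proof.
  intros Hb Hz Hx.
  assert (H : Rpower (1 - z) (- b) - binom_sum b K z
              <= Rpower (1 - x) (- b) - binom_sum b K x).
  { assert (Hsh : forall t, 0 <= t < 1 -> Un_cv (fun p => binom_sum b (K + p) t - binom_sum b K t)
                 (Rpower (1 - t) (- b) - binom_sum b K t)).
    { intros t Ht. apply CV_minus; [|apply Un_cv_const].
      apply binom_sum_shift_cv; assumption. }
    eapply Un_cv_le; [|apply Hsh; lra|apply Hsh; lra].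
    intro p; cbv beta. apply (binom_sum_tail_incr b z x K p Hb Hz). }
  pose proof (binom_sum_ge1 b z K Hb ltac:(lra)).
  pose proof (binom_sum_le b x K Hb ltac:(lra)).
  unfold binom_excess. nra.
Qed.

Lemma binom_excess_cv (b x : R) : 0 < b -> 0 <= x < 1 -> Un_cv (binom_excess b x) 1.
Proof.
  intros Hb Hx.
  replace 1 with (1 + (Rpower (1 - x) (- b) - Rpower (1 - x) (- b))) by ring.
  apply CV_plus; [apply Un_cv_const|]. apply CV_minus; [apply Un_cv_const|].
  apply binom_sum_cv; assumption.
Qed.

(** * Partial sums of [F_D] *)

Lemma prodR_ext (n : nat) (f g : nat -> R) :
  (forall i, (i < n)%nat -> f i = g i) -> prodR n f = prodR n g.
Proof.
  induction n as [|n IH]; intro H; simpl; [reflexivity|].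
  rewrite IH by (intros; apply H; lia). rewrite H by lia; reflexivity.
Qed.

Lemma prodR_mult (n : nat) (f g : nat -> R) :
  prodR n (fun i => f i * g i) = prodR n f * prodR n g.
Proof. induction n as [|n IH]; simpl; [ring|]. rewrite IH; ring. Qed.

Lemma prodR_pos (n : nat) (f : nat -> R) :
  (forall i, (i < n)%nat -> 0 < f i) -> 0 < prodR n f.
Proof.
  induction n as [|n IH]; intro H; simpl; [lra|].
  apply Rmult_lt_0_compat; [apply IH; intros; apply H; lia | apply H; lia].
Qed.

Lemma prodR_le (n : nat) (f g : nat -> R) :
  (forall i, (i < n)%nat -> 0 < f i <= g i) -> prodR n f <= prodR n g.
Proof.
  induction n as [|n IH]; intro H; simpl; [lra|].
  apply Rmult_le_compat.
  - left; apply prodR_pos; intros i Hi; apply H; lia.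
  - apply Rlt_le, H; lia.
  - apply IH; intros i Hi; apply H; lia.
  - apply H; lia.
Qed.

Lemma prodR_Rpower (n : nat) (f : nat -> R) (b : R) :
  (forall i, (i < n)%nat -> 0 < f i) ->
  prodR n (fun i => Rpower (f i) b) = Rpower (prodR n f) b.
Proof.
  induction n as [|n IH]; intro H; simpl.
  - unfold Rpower; rewrite ln_1, Rmult_0_r, exp_0; reflexivity.
  - rewrite IH by (intros; apply H; lia). apply Rpower_mult_distr.
    + apply prodR_pos; intros; apply H; lia.
    + apply H; lia.
Qed.

Lemma prodR_cv (n : nat) (u : nat -> nat -> R) (l : nat -> R) :
  (forall i, (i < n)%nat -> Un_cv (u i) (l i)) ->
  Un_cv (fun K => prodR n (fun i => u i K)) (prodR n l).
Proof.
  induction n as [|n IH]; intro H; simpl.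
  - apply Un_cv_const.
  - apply (CV_mult (fun K => prodR n (fun i => u i K)) (u n)).
    + apply IH; intros; apply H; lia.
    + apply H; lia.
Qed.

Lemma sum_f_R0_cv (K : nat) (u : nat -> nat -> R) (l : nat -> R) :
  (forall i, (i <= K)%nat -> Un_cv (u i) (l i)) ->
  Un_cv (fun M => sum_f_R0 (fun i => u i M) K) (sum_f_R0 l K).
Proof.
  induction K as [|K IH]; intro H; simpl.
  - apply (H 0%nat); lia.
  - apply (CV_plus (fun M => sum_f_R0 (fun i => u i M) K) (u (S K))).
    + apply IH; intros; apply H; lia.
    + apply H; lia.
Qed.

(* Under the urn (in the limit: under a Beta(a, c - a) variable [u]) the weights
   [(a)_s / (c)_s] are the moments of [u], so the cube partial sum factorizes. *)
Lemma fd_partial_polya_cv (a c bb : R) (x : nat -> R) (n K s : nat) (w : R) :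
  0 <= a -> a < c ->
  Un_cv (fun M => polya a (c - a) (S M) (fun j =>
           w * ((INR j / INR (S M)) ^ s
             * prodR n (fun l => binom_sum bb K (x l * (INR j / INR (S M)))))))
        (fd_partial a c (fun _ => bb) x n K s w).
Proof.
  intros Ha Hc. revert s w. induction n as [|n IH]; intros s w; simpl fd_partial.
  - apply Un_cv_ext with (fun M => polya a (c - a) (S M) (fun j => (INR j / INR (S M)) ^ s) * w).
    { intro M. rewrite Rmult_comm, <- polya_scal. apply polya_ext. intro j; simpl; ring. }
    apply CV_mult; [|apply Un_cv_const].
    pose proof (polya_pow_cv a (c - a) s Ha ltac:(lra)) as H.
    replace (a + (c - a)) with c in H by ring. exact H.
  - eapply Un_cv_ext; [|apply sum_f_R0_cv; intros i _; apply IH].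
    (* By linearity the sum over the index [i] moves inside the expectation, where
       [u^(s+i) = u^s u^i] and [u^i] joins [x^i] to form one more binomial sum. *)
    intro M. cbv beta. rewrite <- polya_sum. apply polya_ext. intro j.
    cbn [prodR]. set (u := INR j / INR (S M)).
    set (G := prodR n (fun l => binom_sum bb K (x l * u))).
    unfold binom_sum. rewrite (Rmult_comm G), <- !Rmult_assoc.
    rewrite (Rmult_comm (w * u ^ s)), Rmult_assoc, (Rmult_comm (sum_f_R0 _ K)), scal_sum.
    apply sum_eq. intros i _. unfold binom_coef.
    rewrite pow_add, Rpow_mult_distr. unfold Rdiv; ring.
Qed.

(** The urn expectation is monotone, so a pointwise comparison of kernels survives in the limit.
    Separate truncation orders [K] and [L] let it also compare successive partial sums. *)
Lemma fd_partial_le (a c bb P Q : R) (x y : nat -> R) (n K L : nat) :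
  0 <= a -> a < c ->
  (forall u, 0 <= u <= 1 -> P * prodR n (fun l => binom_sum bb K (x l * u))
                         <= Q * prodR n (fun l => binom_sum bb L (y l * u))) ->
  P * fd_partial a c (fun _ => bb) x n K 0 1 <= Q * fd_partial a c (fun _ => bb) y n L 0 1.
Proof.
  intros Ha Hc H.
  eapply Un_cv_le; cycle 1.
  - apply (CV_mult (fun _ => P)); [apply Un_cv_const | apply fd_partial_polya_cv; assumption].
  - apply (CV_mult (fun _ => Q)); [apply Un_cv_const | apply fd_partial_polya_cv; assumption].
  - intro M. cbv beta. rewrite <- !polya_scal. apply polya_le; [lra|lra|].
    intros j Hj. cbn [pow]. rewrite !Rmult_1_l. apply H.
    assert (HM : 0 < INR (S M)) by (apply lt_0_INR; lia).
    split; [apply Rdiv_le_0_compat; [apply pos_INR | exact HM]|].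
    apply Rle_div_l; [exact HM|]. rewrite Rmult_1_l. apply le_INR, Hj.
Qed.

(** The cube partial sums increase with [K] and are bounded by the full kernel at [u = 1], which is
    finite because [x i < 1]. Hence the [epsilon] choice is their limit. *)
Lemma LauricellaFD_cv (n : nat) (a c bb : R) (x : nat -> R) :
  0 <= a -> a < c -> 0 < bb -> (forall i, (i < n)%nat -> 0 <= x i < 1) ->
  Un_cv (fun K => fd_partial a c (fun _ => bb) x n K 0 1)
        (LauricellaFD n a (fun _ => bb) c x).
Proof.
  intros Ha Hc Hb Hx. unfold LauricellaFD. apply epsilon_spec.
  assert (Hxu : forall i u, (i < n)%nat -> 0 <= u <= 1 -> 0 <= x i * u <= x i).
  { intros i u Hi Hu. pose proof (Hx i Hi). nra. }
  destruct (growing_cv (fun K => fd_partial a c (fun _ => bb) x n K 0 1)) as [l Hl].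
  - intro K. rewrite <- (Rmult_1_l (fd_partial _ _ _ _ _ K _ _)).
    rewrite <- (Rmult_1_l (fd_partial _ _ _ _ _ (S K) _ _)).
    apply fd_partial_le; [assumption..|]. intros u Hu. rewrite !Rmult_1_l.
    apply prodR_le. intros i Hi. pose proof (Hxu i u Hi Hu).
    split; [pose proof (binom_sum_ge1 bb (x i * u) K Hb ltac:(lra)); lra|].
    pose proof (binom_sum_tail_incr bb (x i * u) (x i * u) K 1 Hb ltac:(lra)) as Hs.
    rewrite Nat.add_1_r in Hs. lra.
  - exists (prodR n (fun i => Rpower (1 - x i) (- bb))). intros y [K ->].
    apply Un_cv_le with (2 := fd_partial_polya_cv a c bb x n K 0 1 Ha Hc)
      (v := fun _ => prodR n (fun i => Rpower (1 - x i) (- bb))); [|apply Un_cv_const].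
    intro M. rewrite <- (polya_const a (c - a) (prodR n _) (S M)) by lra.
    apply polya_le; [lra|lra|]. intros j Hj. cbn [pow]. rewrite !Rmult_1_l.
    assert (HM : 0 < INR (S M)) by (apply lt_0_INR; lia).
    assert (Hu : 0 <= INR j / INR (S M) <= 1).
    { split; [apply Rdiv_le_0_compat; [apply pos_INR | exact HM]|].
      apply Rle_div_l; [exact HM|]. rewrite Rmult_1_l. apply le_INR, Hj. }
    apply prodR_le. intros i Hi. pose proof (Hxu i _ Hi Hu). pose proof (Hx i Hi).
    pose proof (binom_sum_ge1 bb (x i * (INR j / INR (S M))) K Hb ltac:(lra)).
    split; [lra|].
    eapply Rle_trans; [|apply (binom_sum_le bb (x i) K Hb); lra].
    pose proof (binom_sum_tail_incr bb (x i * (INR j / INR (S M))) (x i) 0 K Hb ltac:(lra)) as Hs.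
    assert (E : forall t, binom_sum bb 0 t = 1).
    { intro t; unfold binom_sum, binom_coef; simpl; field. }
    rewrite !E in Hs; simpl Nat.add in Hs. lra.
  - exists l; exact Hl.
Qed.

(** * Hadamard's inequality *)

Module HadamardDet.
Import all_boot all_order all_algebra Rstruct.
Import Order.TTheory GRing.Theory Num.Theory.
Local Open Scope ring_scope.

Lemma posdef_diag_gt0 (F : realFieldType) (n : nat) (B : 'M[F]_n) (i : 'I_n) :
  (forall x : 'rV[F]_n, x != 0 -> 0 < (x *m B *m x^T) 0 0) -> 0 < B i i.
Proof.
move=> posB; have := posB (delta_mx 0 i); rewrite -rowE trmx_delta -colE !mxE.
apply; apply/eqP => /matrixP /(_ 0 i) /eqP.
by rewrite !mxE !eqxx oner_eq0.
Qed.

(* Induction through the Schur complement of the top-left entry, which only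
   decreases the remaining diagonal entries. *)
Lemma hadamard (F : realFieldType) (n : nat) (B : 'M[F]_n) :
  B^T = B -> (forall x : 'rV[F]_n, x != 0 -> 0 < (x *m B *m x^T) 0 0) ->
  0 < \det B <= \prod_(i < n) B i i.
Proof.
elim: n B => [|n IHn] B symB posB.
  by rewrite det_mx00 big_ord0 ltr01 lexx.
have b_gt0 : 0 < B 0 0 by apply: posdef_diag_gt0.
set b := B 0 0 in b_gt0; have b_neq0 : b != 0 by rewrite gt_eqF.
pose v : 'rV[F]_n := @ursubmx _ 1 n 1 n B.
pose B' : 'M[F]_n := @drsubmx _ 1 n 1 n B.
have B_E : B = block_mx b%:M v v^T B' :> 'M_(1 + n).
  rewrite -[LHS](@submxK _ 1 n 1 n); congr block_mx.
    apply/matrixP => i j; rewrite !ord1 !mxE eqxx mulr1n.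
    by congr (B _ _); apply/val_inj.
  apply/matrixP => i j; rewrite ord1 !mxE.
  by rewrite -[in LHS]symB mxE.
have symB' : B'^T = B'.
  by apply/matrixP => i j; rewrite !mxE -[in LHS]symB mxE.
(* The Schur complement of the entry [b]. *)
pose S := B' - b^-1 *: (v^T *m v).
have symS : S^T = S by rewrite /S linearB linearZ /= trmx_mul trmxK symB'.
have posS (x : 'rV[F]_n) : x != 0 -> 0 < (x *m S *m x^T) 0 0.
  (* For fixed [x] this first coordinate minimizes the quadratic form of [B], and the minimum is the
     form of [S] at [x]. *)
  move=> x_neq0; pose y : 'rV_(1 + n) := row_mx (- (b^-1 *: (x *m v^T))) x.
  have -> : x *m S *m x^T = y *m (B : 'M_(1 + n)) *m y^T.
    rewrite B_E mul_row_block tr_row_mx mul_row_col.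
    rewrite mul_mx_scalar scalerN scalerA divff // scale1r addNr mul0mx add0r.
    by rewrite /S mulmxBr mulNmx addrC -scalemxAr -scalemxAl mulmxA.
  apply: posB; apply: contra_neq x_neq0 => /(congr1 (@rsubmx F 1 1 n)).
  by rewrite row_mxKr => ->; apply/matrixP => i j; rewrite !mxE.
have [/andP[detS_gt0 detS_le]] := (IHn S symS posS).
have detB : \det B = b * \det S.
  (* One step of Gaussian elimination; the left factor has determinant 1. *)
  have E : B = block_mx 1%:M 0 (b^-1 *: v^T) 1%:M *m block_mx b%:M v 0 S :> 'M_(1 + n).
    rewrite mulmx_block !mul1mx !mul0mx !addr0 B_E; congr block_mx.
      by rewrite mul_mx_scalar scalerA divff // scale1r.
    by rewrite /S -scalemxAl addrC subrK.
  rewrite (congr1 (fun M : 'M_(1 + n) => \det M) E) det_mulmx.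
  by rewrite det_lblock det_ublock !det1 !mul1r det_scalar1.
rewrite detB mulr_gt0 //= big_ord_recl ler_pM2l //.
apply: le_trans detS_le _; apply: ler_prod => i _.
rewrite ltW ?posdef_diag_gt0 //= !mxE.
have -> : B (rshift 1 i) (rshift 1 i) = B (lift ord0 i) (lift ord0 i).
  by congr (B _ _); apply/val_inj.
(* A diagonal entry of [S] is that of [B'] minus a square divided by [b]. *)
rewrite lerBlDr lerDl mulr_ge0 ?invr_ge0 ?(ltW b_gt0) // big_ord1 !mxE.
by rewrite -expr2 sqr_ge0.
Qed.

(** * Transfer to families indexed by natural numbers, and eigenvalue products *)

Lemma sumRE n (f : nat -> R) : sumR n f = \sum_(i < n) f i.
Proof. by elim: n => [|n IHn]; rewrite ?big_ord0 // big_ord_recr /= IHn. Qed.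

Lemma prodRE n (f : nat -> R) : prodR n f = \prod_(i < n) f i.
Proof. by elim: n => [|n IHn]; rewrite ?big_ord0 // big_ord_recr /= IHn. Qed.

(** Both sides expand along row 0; skipping column [j] in [minor] is the map [bump j]. *)
Lemma detE n (A : nat -> nat -> R) : det n A = \det (\matrix_(i < n, j < n) A i j).
Proof.
elim: n A => [|n IHn] A; first by rewrite det_mx00.
rewrite (expand_det_row _ ord0).
rewrite -[LHS]/(sumR n.+1 (fun j => Rmult (Rmult (pow (-1) j) (A 0%N j)) (det n (minor A j)))).
rewrite sumRE; apply: eq_bigr => j _.
rewrite IHn mxE /cofactor add0n RpowE !RmultE (opp_IZR 1) RoppE mulrCA -mulrA.
congr (_ * (_ * \det _)).
apply/matrixP => r c; rewrite !mxE /minor; congr (A _ _).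
rewrite /= /bump; case: PeanoNat.Nat.ltb_spec => [/ssrnat.ltP|/ssrnat.leP ->] //.
by rewrite ltnNge => /negbTE->.
Qed.

(* [tau I + D C = D (tau D^-1 + C)], and the second factor is symmetric positive
   definite with diagonal entries [tau / lam i + 1]. *)
Lemma det_shift_bounds (n : nat) (lam : nat -> R) (C : nat -> nat -> R) (tau : R) :
  0 <= tau -> (forall i, (i < n)%coq_nat -> 0 < lam i) ->
  Defs.symmetric n C -> pos_def n C -> (forall i, (i < n)%coq_nat -> C i i = 1) ->
  0 < \det (\matrix_(i < n, j < n) (tau *+ (i == j) + lam i * C i j))
    <= \prod_(i < n) (tau + lam i).
Proof.
move=> tau_ge0 lam_gt0 symC posC diagC.
have lam_pos (i : 'I_n) : 0 < lam i by apply: lam_gt0; apply/ssrnat.ltP.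
pose B : 'M[R]_n := \matrix_(i, j) ((tau / lam i) *+ (i == j) + C i j).
have -> : \matrix_(i < n, j < n) (tau *+ (i == j) + lam i * C i j)
    = diag_mx (\row_i lam i) *m B.
  apply/matrixP => i j; rewrite mul_diag_mx !mxE mulrDr mulrnAr.
  by rewrite mulrCA divff ?mulr1 // gt_eqF.
have symB : B^T = B.
  apply/matrixP => i j; rewrite !mxE (symC j i); try exact/ssrnat.ltP.
  by rewrite eq_sym; case: eqVneq => [->|].
have posB (x : 'rV[R]_n) : x != 0 -> 0 < (x *m B *m x^T) 0 0.
  move=> x_neq0.
  have /existsP[i xi_neq0] : [exists i, x 0 i != 0].
    apply: contra_neqT x_neq0; rewrite negb_exists => /forallP x0.
    by apply/matrixP => i j; rewrite ord1 mxE; apply/eqP; rewrite -[_ == _]negbK.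
  (* [pos_def] quantifies over functions on all naturals, so the vector is extended by zero. *)
  pose f k := if insub k is Some i then x 0 i else 0.
  have fE (j : 'I_n) : f j = x 0 j by rewrite /f valK.
  have fi_neq0 : f i <> 0 by rewrite fE; apply/eqP.
  have /RltP := posC f (ex_intro _ (i : nat) (conj (ssrnat.ltP (ltn_ord i)) fi_neq0)).
  rewrite sumRE => posx.
  (* The form of [B] is a diagonal form, nonnegative because [tau >= 0], plus the positive form of
     [C]. *)
  have -> : (x *m B *m x^T) 0 0 =
      \sum_(i < n) tau / lam i * x 0 i ^+ 2 + \sum_(i < n) \sum_(j < n) x 0 i * C i j * x 0 j.
    rewrite mxE exchange_big -big_split /=; apply: eq_bigr => j _.
    rewrite !mxE mulr_suml [in X in _ = X + _]
      (_ : _ * _ = \sum_(i < n) x 0 i * (tau / lam i *+ (i == j)) * x 0 j).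
      by rewrite -big_split /=; apply: eq_bigr => l _; rewrite !mxE mulrDr mulrDl.
    rewrite (bigD1 j) //= eqxx mulr1n big1 ?addr0; first by rewrite [RHS]mulrAC -expr2 mulrC.
    by move=> l /negbTE->; rewrite mulr0n mulr0 mul0r.
  rewrite ltr_wpDl //.
    by apply: sumr_ge0 => l _; rewrite mulr_ge0 ?sqr_ge0 // divr_ge0 // ltW.
  suff <- : \sum_(i < n) sumR n (fun j => Rmult (Rmult (f i) (C i j)) (f j))
     = \sum_(i < n) \sum_(j < n) x 0 i * C i j * x 0 j by [].
  by apply: eq_bigr => l _; rewrite sumRE; apply: eq_bigr => j _; rewrite !fE.
have /andP[detB_gt0 detB_le] := hadamard _ _ _ symB posB.
rewrite det_mulmx det_diag.
have prod_gt0 : 0 < \prod_(i < n) (\row_i0 lam i0) 0 i.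
  by apply: prodr_gt0 => i _; rewrite mxE.
rewrite mulr_gt0 //=.
apply: (le_trans (y := \prod_(i < n) (\row_i0 lam i0) 0 i * \prod_(i < n) B i i)).
  by rewrite ler_pM2l.
rewrite -big_split /=; under eq_bigr => i _ do
  rewrite !mxE eqxx mulr1n mulrDr mulrCA divff ?gt_eqF // mulr1
    (diagC _ (ssrnat.ltP (ltn_ord i))) mulr1.
by [].
Qed.

(** The characteristic polynomial at [- tau]; the sign [(-1)^n] appears on both sides and
    cancels. *)
Lemma eigenvalues_shift (n : nat) (A : nat -> nat -> R) (mu : nat -> R) (tau : R) :
  is_eigenvalues n A mu ->
  \prod_(i < n) (tau + mu i) = \det (\matrix_(i < n, j < n) (tau *+ (i == j) + A i j)).
Proof.
move=> /(_ (- tau)); rewrite detE prodRE => E.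
have -> : \matrix_(i < n, j < n) (tau *+ (i == j) + A i j) =
  -1 *: \matrix_(i < n, j < n) (Rminus (if Nat.eqb i j then - tau else 0) (A i j)).
  apply/matrixP => i j; rewrite !mxE mulN1r RminusE opprB addrC; congr (_ + _).
  by rewrite (_ : Nat.eqb i j = (i == j)) //; case: (i == j); rewrite ?opprK ?oppr0.
rewrite detZ E -[X in _ ^+ X](card_ord n) -prodr_const -big_split /=.
by apply: eq_bigr => i _; rewrite RminusE mulN1r opprB opprK addrC.
Qed.

Lemma eigenvalues_prod_bounds (n : nat) (lam mu : nat -> R) (C : nat -> nat -> R) (tau : R) :
  Rle 0 tau -> (forall i, (i < n)%coq_nat -> Rlt 0 (lam i)) ->
  Defs.symmetric n C -> pos_def n C -> (forall i, (i < n)%coq_nat -> C i i = 1%R) ->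
  is_eigenvalues n (fun i j => Rmult (lam i) (C i j)) mu ->
  Rlt 0 (prodR n (fun i => Rplus tau (mu i))) /\
  Rle (prodR n (fun i => Rplus tau (mu i))) (prodR n (fun i => Rplus tau (lam i))).
Proof.
move=> /RleP tau_ge0 lam_gt0 symC posC diagC eig.
have lam_gt0' i : (i < n)%coq_nat -> 0 < lam i by move=> /lam_gt0 /RltP.
rewrite !prodRE; under eq_bigr => i _ do rewrite RplusE.
rewrite (eigenvalues_shift _ _ _ tau eig).
by have /andP[/RltP ? /RleP ?] := det_shift_bounds _ _ _ _ tau_ge0 lam_gt0' symC posC diagC.
Qed.

End HadamardDet.

(** * Comparison of the coverage probabilities *)

Lemma prodR_zero (n i : nat) (f : nat -> R) : (i < n)%nat -> f i = 0 -> prodR n f = 0.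
Proof.
  intros Hi Hf. induction n as [|n IH]; [lia|]. simpl.
  destruct (Nat.eq_dec i n) as [->|Hne]; [rewrite Hf; ring|].
  rewrite IH by lia; ring.
Qed.

Lemma prodR_const (n : nat) (c : R) : prodR n (fun _ => c) = c ^ n.
Proof. induction n as [|n IH]; simpl; [reflexivity|]. rewrite IH; ring. Qed.

(** Since [1 - u / (y + 1) = (1 - u + y) / (y + 1)], the prefactor cancels the denominators. *)
Lemma prod_kernel (n : nat) (b u : R) (y : nat -> R) :
  0 <= u <= 1 -> (forall i, (i < n)%nat -> 0 < y i) ->
  prodR n (fun i => Rpower (1 / (y i + 1)) b)
  * prodR n (fun i => Rpower (1 - 1 / (y i + 1) * u) (- b))
  = Rpower (prodR n (fun i => 1 - u + y i)) (- b).
Proof.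
  intros Hu Hy. rewrite <- prodR_mult, <- prodR_Rpower.
  2:{ intros i Hi. pose proof (Hy i Hi); lra. }
  apply prodR_ext. intros i Hi. pose proof (Hy i Hi).
  assert (Hx : 0 < 1 / (y i + 1)) by (apply Rdiv_lt_0_compat; lra).
  replace (1 - 1 / (y i + 1) * u) with ((1 - u + y i) * (1 / (y i + 1))) by (field; lra).
  rewrite <- Rpower_mult_distr by lra.
  rewrite (Rmult_comm (Rpower (1 - u + y i) _)), <- Rmult_assoc, <- Rpower_plus.
  rewrite Rplus_opp_r, Rpower_O by exact Hx. ring.
Qed.

(** If [mu i <= 0], then [tau = - mu i] is admissible and annihilates a product already shown to be
    positive. *)
Lemma eigenvalues_pos (n : nat) (lam mu : nat -> R) (C : nat -> nat -> R) :
  (forall i, (i < n)%nat -> 0 < lam i) ->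
  symmetric n C -> pos_def n C -> (forall i, (i < n)%nat -> C i i = 1) ->
  is_eigenvalues n (fun i j => lam i * C i j) mu ->
  forall i, (i < n)%nat -> 0 < mu i.
Proof.
  intros Hlam Hs Hp Hd He i Hi. apply Rnot_le_lt. intro Hmu.
  destruct (HadamardDet.eigenvalues_prod_bounds n lam mu C (- mu i)
    ltac:(lra) Hlam Hs Hp Hd He) as [H _].
  rewrite (prodR_zero n i) in H; [lra | exact Hi | ring].
Qed.

Theorem theorem6 (N : nat) (mc m k : R) (lam lamh : nat -> R)
  (C : nat -> nat -> R) :
  (1 <= N)%nat -> 0 < mc -> 0 < m -> m <= 1 -> 0 < k ->
  (forall i, (i < N)%nat -> 0 < lam i) ->
  symmetric N C -> pos_def N C ->
  (forall i, (i < N)%nat -> C i i = 1) ->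
  is_eigenvalues N (fun i j => lam i * C i j) lamh ->
  Cp N mc m k lam <= Cp N mc m k lamh.
Proof.
  intros HN Hmc Hm Hm1 Hk Hlam Hsym Hpd Hdiag Heig.
  pose proof (eigenvalues_pos N lam lamh C Hlam Hsym Hpd Hdiag Heig) as Hlamh.
  assert (HN0 : 0 < INR N * mc) by (apply Rmult_lt_0_compat; [apply lt_0_INR; lia | exact Hmc]).
  assert (Hkm : 0 < k * m) by (apply Rmult_lt_0_compat; assumption).
  unfold Cp. rewrite !Rmult_assoc. apply Rmult_le_compat_l.
  { unfold Rdiv. apply Rmult_le_pos; [apply Gamma_nonneg; lra|].
    (* As only nonnegativity of [Gamma] is established, a zero denominator is treated through the
       convention [/ 0 = 0]. *)
    destruct (Rmult_le_pos _ _ (Gamma_nonneg (INR N * mc + 1) ltac:(lra)) (Gamma_nonneg m Hm))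
      as [H|H].
    - left; apply Rinv_0_lt_compat, H.
    - rewrite <- H, Rinv_0; lra. }
  assert (Hy : forall mu : nat -> R, (forall i, (i < N)%nat -> 0 < mu i) ->
            forall i, (i < N)%nat -> 0 < k * m * mu i).
  { intros mu H i Hi. apply Rmult_lt_0_compat; [exact Hkm | apply H, Hi]. }
  assert (Hx : forall mu : nat -> R, (forall i, (i < N)%nat -> 0 < mu i) ->
            forall i, (i < N)%nat -> 0 < 1 / (k * m * mu i + 1) < 1).
  { intros mu H i Hi. pose proof (Hy mu H i Hi). split; [apply Rdiv_lt_0_compat; lra|].
    apply Rlt_div_l; lra. }
  set (x := fun i => 1 / (k * m * lam i + 1)).
  set (xh := fun i => 1 / (k * m * lamh i + 1)).
  set (P := prodR N (fun i => Rpower (1 / (k * m * lam i + 1)) mc)).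
  set (Q := prodR N (fun i => Rpower (1 / (k * m * lamh i + 1)) mc)).
  assert (HP : 0 < P) by (apply prodR_pos; intros; apply exp_pos).
  assert (HQ : 0 < Q) by (apply prodR_pos; intros; apply exp_pos).
  (* The kernel inequality holds for full series, not evidently for truncated ones. Truncation only
     lowers the left side, and [rho K], tending to 1, makes up for the loss on the right. *)
  set (rho := fun K => prodR N (fun i => binom_excess mc (xh i) K)).
  assert (Hrho : Un_cv rho 1).
  { rewrite <- (pow1 N), <- prodR_const. apply prodR_cv. intros i Hi.
    apply binom_excess_cv; [exact Hmc|].
    pose proof (Hx lamh Hlamh i Hi). unfold xh; lra. }
  assert (Hker : forall u, 0 <= u <= 1 ->
    P * prodR N (fun i => Rpower (1 - x i * u) (- mc))
    <= Q * prodR N (fun i => Rpower (1 - xh i * u) (- mc))).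
  { intros u Hu. unfold P, Q, x, xh.
    rewrite (prod_kernel N mc u (fun i => k * m * lam i)) by auto.
    rewrite (prod_kernel N mc u (fun i => k * m * lamh i)) by auto.
    (* Extracting [k m] from each factor gives the form [tau + mu i] with
       [tau = (1 - u) / (k m) >= 0]. *)
    assert (Hfac : forall mu : nat -> R, prodR N (fun i => 1 - u + k * m * mu i)
              = (k * m) ^ N * prodR N (fun i => (1 - u) / (k * m) + mu i)).
    { intro mu. rewrite <- prodR_const, <- prodR_mult. apply prodR_ext. intros i _. field; lra. }
    rewrite !Hfac.
    destruct (HadamardDet.eigenvalues_prod_bounds N lam lamh C ((1 - u) / (k * m))
      ltac:(apply Rdiv_le_0_compat; lra) Hlam Hsym Hpd Hdiag Heig) as [H1 H2].
    pose proof (pow_lt (k * m) N Hkm) as H3.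
    (* The negative exponent reverses the Hadamard bound. *)
    rewrite !Rpower_Ropp. apply Rinv_le_contravar; [apply exp_pos|].
    apply Rle_Rpower_l; [lra|]. split; [apply Rmult_lt_0_compat; assumption|].
    apply Rmult_le_compat_l; lra. }
  apply Un_cv_le with
    (fun K => P * fd_partial (1 - m) (INR N * mc + 1) (fun _ => mc) x N K 0 1)
    (fun K => rho K * Q * fd_partial (1 - m) (INR N * mc + 1) (fun _ => mc) xh N K 0 1).
  - intro K. apply fd_partial_le; [lra|lra|]. intros u Hu.
    apply Rle_trans with (P * prodR N (fun i => Rpower (1 - x i * u) (- mc))).
    { apply Rmult_le_compat_l; [lra|]. apply prodR_le. intros i Hi.
      pose proof (Hx lam Hlam i Hi) as Hxi. fold (x i) in Hxi.
      pose proof (binom_sum_ge1 mc (x i * u) K Hmc ltac:(nra)).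
      split; [lra|]. apply binom_sum_le; [exact Hmc | nra]. }
    eapply Rle_trans; [apply Hker, Hu|].
    rewrite (Rmult_comm (rho K)), Rmult_assoc. apply Rmult_le_compat_l; [lra|].
    unfold rho. rewrite <- prodR_mult. apply prodR_le. intros i Hi.
    pose proof (Hx lamh Hlamh i Hi) as Hxi. fold (xh i) in Hxi.
    split; [apply exp_pos|]. apply binom_le_excess; [exact Hmc | nra | lra].
  - apply (CV_mult (fun _ => P)); [apply Un_cv_const|].
    apply LauricellaFD_cv; [lra|lra|exact Hmc|].
    intros i Hi. pose proof (Hx lam Hlam i Hi). unfold x; lra.
  - apply (CV_mult (fun K => rho K * Q)).
    + pose proof (CV_mult rho (fun _ => Q) 1 Q Hrho (Un_cv_const Q)) as H.
      rewrite Rmult_1_l in H; exact H.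
    + apply LauricellaFD_cv; [lra|lra|exact Hmc|].
      intros i Hi. pose proof (Hx lamh Hlamh i Hi). unfold xh; lra.
Qed.
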